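(* For every positive integer $n$, there exists a $P_{3n}$-induced-saturated graph.
   Context: All graphs are finite and simple. $P_k$ denotes the path on $k$ vertices. For a graph $H$, a graph $G$ is $H$-induced-saturated if $G$ does not contain an induced subgraph isomorphic to $H$, but for every edge $e$ of $G$ the graph $G-e$ contains an induced copy of $H$, and for every non-edge $e$ of $G$ (an unordered pair of distinct non-adjacent vertices) the graph $G+e$ contains an induced copy of $H$. *)

(* Defs.v *)
From mathcomp Require Import all_boot.

Set Implicit Arguments.
Unset Strict Implicit.
Unset Printing Implicit Defensive.

Record sgraph := SGraph {
  vertex :> finType;
  adj : rel vertex;
  adj_sym : symmetric adj;
  adj_irr : irreflexive adj }.

Section Operations.
Variable G : sgraph.
Implicit Types (S : {set G}) (x y u v : G).

Definition induced_adj S : rel {x : G | x \in S} :=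
  fun a b => adj (val a) (val b).

Fact induced_adj_sym S : symmetric (@induced_adj S).
Proof. by move=> a b; apply: adj_sym. Qed.

Fact induced_adj_irr S : irreflexive (@induced_adj S).
Proof. by move=> a; apply: adj_irr. Qed.

Definition induced S : sgraph :=
  SGraph (@induced_adj_sym S) (@induced_adj_irr S).

Definition del_adj x y : rel G :=
  fun u v => adj u v && ([set u; v] != [set x; y]).

Fact del_adj_sym x y : symmetric (del_adj x y).
Proof. by move=> u v; rewrite /del_adj adj_sym setUC. Qed.

Fact del_adj_irr x y : irreflexive (del_adj x y).
Proof. by move=> u; rewrite /del_adj adj_irr. Qed.

Definition del_edge x y : sgraph := SGraph (del_adj_sym x y) (del_adj_irr x y).

(* The guard [u != v] keeps the result loopless when x = y, in which case
   nothing is added. *)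
Definition add_adj x y : rel G :=
  fun u v => (u != v) && (adj u v || ([set u; v] == [set x; y])).

Fact add_adj_sym x y : symmetric (add_adj x y).
Proof. by move=> u v; rewrite /add_adj eq_sym adj_sym setUC. Qed.

Fact add_adj_irr x y : irreflexive (add_adj x y).
Proof. by move=> u; rewrite /add_adj eqxx. Qed.

Definition add_edge x y : sgraph := SGraph (add_adj_sym x y) (add_adj_irr x y).

End Operations.

Definition isomorphic (G H : sgraph) : Prop :=
  exists2 f : G -> H, bijective f & forall u v : G, adj (f u) (f v) = adj u v.

Definition contains_induced (G H : sgraph) : Prop :=
  exists S : {set G}, isomorphic (induced S) H.

Section Path.
Variable k : nat.

Definition path_adj : rel 'I_k :=
  fun i j => (i.+1 == j :> nat) || (j.+1 == i :> nat).

Fact path_adj_sym : symmetric path_adj.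
Proof. by move=> i j; rewrite /path_adj orbC. Qed.

Fact path_adj_irr : irreflexive path_adj.
Proof. by move=> i; rewrite /path_adj orbb; apply/negbTE; rewrite gtn_eqF. Qed.

Definition path_graph : sgraph := SGraph path_adj_sym path_adj_irr.

End Path.

(* Graphs on at most one vertex, having neither edges nor non-edges, are
   vacuously H-induced-saturated for every H on at least two vertices;
   existence claims are only meaningful together with [1 < #|G|]. *)
Definition induced_saturated (H G : sgraph) : Prop :=
  [/\ ~ contains_induced G H,
      forall x y : G, adj x y -> contains_induced (del_edge x y) H
    & forall x y : G, x != y -> ~~ adj x y ->
        contains_induced (add_edge x y) H].

(* Main.v *)
Require Import Defs.
From mathcomp Require Import all_boot zify.

(** For [n = 1] take a triangle.  For [n > 1] put [m = 3n - 1] and take the complementary prism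
    of the cycle [C_m]: an outer cycle on vertices [u_i], the complement of that cycle on inner
    vertices [v_i], and the spokes [u_i v_i]; for [m = 5] this is the Petersen graph.  It is
    [P_(m+1)]-induced-saturated for every [m >= 5].

    No induced [P_(m+1)]: such a path with [s] inner vertices misses exactly [s - 1] outer
    ones.  The inner vertices induce a forest inside the complement of a cycle, so [s <= 4];
    for each [s] the degree bound 2, acyclicity and having only two leaves are contradicted
    locally, around the inner indices.

    Saturation: up to rotation and reflection a pair of vertices has indices [0] and [j], and
    an explicit path on [m + 1] vertices appears when the pair is flipped. *)

Set Implicit Arguments.
Unset Strict Implicit.
Unset Printing Implicit Defensive.

(* The first component is [true] for outer vertices and [false] for inner ones; [c] is the
   adjacency of the outer cycle. *)
Definition prism_rel (T : eqType) (c : rel T) (u v : bool * T) : bool :=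
  if u.1 != v.1 then u.2 == v.2
  else (u.2 != v.2) && (if u.1 then c u.2 v.2 else ~~ c u.2 v.2).

Lemma prism_rel_sym (T : eqType) (c : rel T) : symmetric c -> symmetric (prism_rel c).
Proof.
move=> c_sym [a i] [b j]; rewrite /prism_rel /= [b == a]eq_sym [j == i]eq_sym c_sym.
by case: eqVneq => //= ->.
Qed.

Local Notation U i := (true, i).
Local Notation V i := (false, i).

(** * Properties of an induced path *)

Definition leaf_in (T : finType) (e : rel T) (A : {set T}) (x : T) : Prop :=
  {in A &, forall a b, e x a -> e x b -> a = b}.

(** The exclusion argument sees a path only through these facts and its size. Acyclicity is phrased
    without walks, by a vertex with at most one neighbour in each nonempty subset; [leaf_in] also
    admits isolated vertices. *)
Record path_like (T : finType) (e : rel T) (Q : {set T}) : Prop := PathLike {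
  path_deg : forall x a b d, x \in Q -> a \in Q -> b \in Q -> d \in Q ->
    e x a -> e x b -> e x d -> uniq [:: a; b; d] -> False;
  path_acyclic : forall (A : {set T}) x, A \subset Q -> x \in A ->
    exists2 y, y \in A & leaf_in e A y;
  path_leaves : forall x y z, x \in Q -> y \in Q -> z \in Q ->
    leaf_in e Q x -> leaf_in e Q y -> leaf_in e Q z -> uniq [:: x; y; z] -> False;
  path_nbr : forall x, x \in Q -> exists2 y, y \in Q & e x y }.

Section PathLike.
Variables (G : sgraph) (k : nat) (p : 'I_k -> G).
Hypotheses (inj_p : injective p) (adj_p : forall i j, adj (p i) (p j) = path_adj i j).

Lemma path_like_image : 1 < k -> path_like (@adj G) (p @: 'I_k).
Proof.
move=> k_gt1; split.
- move=> _ _ _ _ /imsetP[x _ ->] /imsetP[a _ ->] /imsetP[b _ ->] /imsetP[d _ ->].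
  rewrite !adj_p /path_adj /= !inE !(inj_eq inj_p) -!val_eqE /=; lia.
- move=> A x /subsetP sAQ Ax; have /imsetP[i0 _ def_x] := sAQ _ Ax.
  rewrite def_x in Ax.
  (* For the vertex of [A] furthest along the path, only its predecessor can be a neighbour in
     [A]. *)
  have [i Ai max_i] := @arg_maxnP _ i0 (fun i => p i \in A) val Ax.
  exists (p i) => // _ _ /[dup] /sAQ /imsetP[a _ ->] Aa /[dup] /sAQ /imsetP[b _ ->] Ab.
  rewrite !adj_p /path_adj; move: (max_i a Aa) (max_i b Ab) => /= le_a le_b ia ib.
  by congr p; apply: val_inj => /=; lia.
(* An interior vertex has two distinct neighbours, so leaves can only be the two ends. *)
- have leafE i : leaf_in (@adj G) (p @: 'I_k) (p i) -> i = 0 :> nat \/ i.+1 = k.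
    move=> leaf_i; have [//|i_gt0] := posnP i; first by left.
    have [lt_ik|] := ltnP i.+1 k; last by have := ltn_ord i; right; lia.
    have lt_i1k : i.-1 < k by lia.
    have inQ j : p j \in p @: 'I_k by apply: imset_f.
    have := leaf_i _ _ (inQ (Ordinal lt_ik)) (inQ (Ordinal lt_i1k)).
    rewrite !adj_p /path_adj /= => nbrs.
    have /inj_p /(congr1 val) /= : p (Ordinal lt_ik) = p (Ordinal lt_i1k) by apply: nbrs; lia.
    lia.
  move=> _ _ _ /imsetP[x _ ->] /imsetP[y _ ->] /imsetP[z _ ->].
  move=> /leafE lx /leafE ly /leafE lz.
  rewrite /= !inE !(inj_eq inj_p) -!val_eqE /=; lia.
- move=> _ /imsetP[i _ ->]; have lt_ik := ltn_ord i.
  have [lt_iSk|] := ltnP i.+1 k.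
    by exists (p (Ordinal lt_iSk)); rewrite ?imset_f // adj_p /path_adj /= eqxx.
  move=> le_k; have lt_i1k : i.-1 < k by lia.
  by exists (p (Ordinal lt_i1k)); rewrite ?imset_f // adj_p /path_adj /=; lia.
Qed.

End PathLike.

Lemma seq_card_le (T : finType) (s : seq T) (A : {set T}) :
  uniq s -> {subset s <= A} -> size s <= #|A|.
Proof.
by move=> uniq_s sA; rewrite cardE; apply: uniq_leq_size => // x /sA; rewrite mem_enum.
Qed.

(** By pigeonhole; a known cardinality thus becomes a finite list of cases. *)
Lemma exhaust (T : finType) (s : seq T) (A : {set T}) x :
  uniq s -> all [in A] s -> #|A| <= size s -> x \in A -> x \in s.
Proof.
move=> us /allP sA leA Ax; apply: contraLR leA => xs; rewrite -ltnNge.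
apply: (@seq_card_le _ (x :: s)); rewrite /= ?xs // => y.
by rewrite inE => /predU1P[->//|/sA].
Qed.

Lemma exists_notin (T : finType) (s : seq T) (A : {set T}) :
  size s < #|A| -> exists2 x, x \in A & x \notin s.
Proof.
move=> lt_sA; apply/exists_inP; apply: contraLR lt_sA.
rewrite negb_exists_in -leqNgt => /forall_inP sub.
apply: leq_trans (card_size s); apply: subset_leq_card.
by apply/subsetP => x /sub; rewrite negbK.
Qed.

(* Swapping [succ] and [pred] gives the reflection symmetry of the cycle. *)
Record cyclic_rel (T : eqType) (c : rel T) (succ pred : T -> T) : Prop := CyclicRel {
  succK : cancel succ pred;
  predK : cancel pred succ;
  cyclicE : forall i j, c i j = (j == succ i) || (j == pred i);
  succ_uniq : forall i, uniq (traject succ i 5);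
  pred_uniq : forall i, uniq (traject pred i 5) }.

Lemma cyclic_rel_rev (T : eqType) (c : rel T) succ pred :
  cyclic_rel c succ pred -> cyclic_rel c pred succ.
Proof. by case=> sK pK cE us up; split=> // i j; rewrite cE orbC. Qed.

(** * Vertex counts and local degrees in a putative long path *)

Section PrismPath.
Variables (T : finType) (c : rel T) (Q : {set bool * T}).
Hypothesis pathQ : path_like (prism_rel c) Q.
Hypothesis cardQ : #|Q| = #|T|.+1.

Let O := [set i | U i \in Q].
Let I := [set i | V i \in Q].

Lemma card_outer_inner : #|O| + #|I| = #|T|.+1.
Proof.
have injP b : injective (@pair bool T b) by move=> i j [].
rewrite -cardQ -(card_imset O (injP true)) -(card_imset I (injP false)) -cardsUI.
rewrite (_ : _ :&: _ = set0) ?cards0 ?addn0.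
  apply: eq_card => -[[] i]; rewrite inE mem_imset // inE.
    by case: imsetP => [[]|]; rewrite ?orbF.
  by case: imsetP => [[]|].
by apply/setP => x; rewrite !inE; apply/negP => /andP[/imsetP[i _ ->] /imsetP[]].
Qed.

(** The path has one vertex more than the outer cycle, so each inner vertex beyond the first is paid
    for by a missing outer one. *)
Lemma card_missing_outer : #|I| = #|~: O|.+1.
Proof. by have := card_outer_inner; have := cardsC O; lia. Qed.

Let e := prism_rel c.

Lemma mem_outer i : (i \in O) = (U i \in Q). Proof. by rewrite inE. Qed.

Lemma mem_inner i : (i \in I) = (V i \in Q). Proof. by rewrite inE. Qed.

Lemma prism_UV i : e (U i) (V i). Proof. by rewrite /e /prism_rel /=. Qed.

Lemma prism_VU i : e (V i) (U i). Proof. by rewrite /e /prism_rel /=. Qed.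

Lemma prism_VV i j : j != i -> ~~ c i j -> e (V i) (V j).
Proof. by rewrite /e /prism_rel /= eq_sym => -> ->. Qed.

Lemma inner_nbr i v : e (V i) v ->
  v = U i \/ exists j, [/\ v = V j, j != i & ~~ c i j].
Proof.
case: v => [[] j]; rewrite /e /prism_rel /=; first by move=> /eqP->; left.
by rewrite eq_sym => /andP[ji cij]; right; exists j.
Qed.

Lemma leaf_inner i j : i \notin O -> (forall x, x \in I -> x != i -> ~~ c i x -> x = j) ->
  leaf_in e Q (V i).
Proof.
rewrite mem_outer => Oi uniq_j a b Qa Qb /inner_nbr[def_a|[x [def_a xi cix]]].
  by rewrite -def_a Qa in Oi.
case/inner_nbr=> [def_b|[y [def_b yi ciy]]]; first by rewrite -def_b Qb in Oi.
have -> : a = V j by rewrite def_a (uniq_j x) // mem_inner -def_a.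
by rewrite def_b (uniq_j y) // mem_inner -def_b.
Qed.

Lemma leaf_inner0 i : (forall x, x \in I -> x != i -> c i x) -> leaf_in e Q (V i).
Proof.
move=> no_nbr a b Qa Qb /inner_nbr[->|[x [def_a xi]]]; last first.
  by rewrite no_nbr // mem_inner -def_a.
case/inner_nbr=> [->//|[y [def_b yi]]].
by rewrite no_nbr // mem_inner -def_b.
Qed.

Section Cycle.
Variables succ pred : T -> T.
Hypothesis csp : cyclic_rel c succ pred.

Lemma succ_neq i :
  [/\ succ i != i, succ (succ i) != i, succ (succ (succ i)) != i
    & succ (succ (succ (succ i))) != i].
Proof.
have := succ_uniq csp i; rewrite /= !inE !negb_or -!andbA.
by case/and5P=> n1 n2 n3 n4 _; rewrite ![_ == i]eq_sym.
Qed.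

Lemma succ_inj : injective succ. Proof. exact: can_inj (succK csp). Qed.

(** A bundle of rewrite rules deciding equality of indices at most four steps apart; it rests on the
    cycle having at least five indices. *)
Lemma succ_eqE :
  (((forall i, (succ i == i) = false) * (forall i, (i == succ i) = false))
  * ((forall i, (succ (succ i) == i) = false) * (forall i, (i == succ (succ i)) = false))
  * ((forall i, (succ (succ (succ i)) == i) = false)
     * (forall i, (i == succ (succ (succ i))) = false))
  * ((forall i, (succ (succ (succ (succ i))) == i) = false)
     * (forall i, (i == succ (succ (succ (succ i)))) = false))
  * (forall i j, (succ i == succ j) = (i == j)))%type.
Proof.
repeat split; last exact: inj_eq succ_inj.
all: move=> i; have [n1 n2 n3 n4] := succ_neq i.
all: by apply/negbTE; rewrite // eq_sym.
Qed.

Lemma cyclic_sym i j : c i j = c j i.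
Proof.
rewrite !(cyclicE csp) orbC; congr (_ || _).
  by rewrite -(inj_eq succ_inj) (predK csp) eq_sym.
by rewrite [RHS]eq_sym -[RHS](inj_eq succ_inj) (predK csp).
Qed.

Lemma cyclic_succ i : c i (succ i). Proof. by rewrite (cyclicE csp) eqxx. Qed.

Lemma cyclic_succ2 i : c i (succ (succ i)) = false.
Proof.
rewrite (cyclicE csp) -[_ == pred i](inj_eq succ_inj) (predK csp) !(inj_eq succ_inj).
by have [/negbTE-> _ /negbTE->] := succ_neq i.
Qed.

(** In a cycle of length four this index would be [pred i]. *)
Lemma cyclic_succ3 i : c i (succ (succ (succ i))) = false.
Proof.
rewrite (cyclicE csp) -[_ == pred i](inj_eq succ_inj) (predK csp) !(inj_eq succ_inj).
by have [_ /negbTE-> _ /negbTE->] := succ_neq i.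
Qed.

Lemma pred_neq_succ i : pred i != succ i.
Proof. by rewrite -(inj_eq succ_inj) (predK csp) eq_sym; case: (succ_neq i). Qed.

Lemma outer_nbr i v : e (U i) v -> [\/ v = U (succ i), v = U (pred i) | v = V i].
Proof.
case: v => [[] j]; rewrite /e /prism_rel /=; last by move=> /eqP->; apply: Or33.
by rewrite (cyclicE csp) => /andP[_ /orP[]/eqP->]; [apply: Or31 | apply: Or32].
Qed.

Lemma prism_succ i : e (U i) (U (succ i)).
Proof.
by rewrite /e /prism_rel /= cyclic_succ andbT eq_sym; case: (succ_neq i).
Qed.

Lemma prism_pred i : e (U i) (U (pred i)).
Proof.
rewrite /e /prism_rel /= (cyclicE csp) eqxx orbT andbT -(inj_eq succ_inj) (predK csp).
by case: (succ_neq i).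
Qed.

Lemma leaf_outer i : i \notin I -> pred i \notin O -> leaf_in e Q (U i).
Proof.
rewrite mem_inner mem_outer => Ii Oi a b Qa Qb /outer_nbr[] def_a /outer_nbr[] def_b;
  by [rewrite def_a def_b | rewrite -def_a Qa in Oi | rewrite -def_b Qb in Oi
     | rewrite -def_a Qa in Ii | rewrite -def_b Qb in Ii].
Qed.

Lemma leaf_outer2 i : succ i \notin O -> pred i \notin O -> leaf_in e Q (U i).
Proof.
rewrite !mem_outer => Os Op a b Qa Qb /outer_nbr[] def_a /outer_nbr[] def_b;
  by [rewrite def_a def_b | rewrite -def_a Qa in Os | rewrite -def_b Qb in Os
     | rewrite -def_a Qa in Op | rewrite -def_b Qb in Op].
Qed.

Lemma outer_not_full i : i \in O -> i \in I -> succ i \in O -> pred i \in O -> False.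
Proof.
rewrite !mem_outer mem_inner => Oi Ii Os Op.
apply: (path_deg pathQ Oi Ii Os Op (prism_UV i) (prism_succ i) (prism_pred i)).
by rewrite /= !inE !xpair_eqE /= eq_sym pred_neq_succ.
Qed.

End Cycle.

Lemma inner_not_full i j l : i \in O -> i \in I -> j \in I -> l \in I ->
  j != i -> l != i -> j != l -> ~~ c i j -> ~~ c i l -> False.
Proof.
rewrite mem_outer !mem_inner => Oi Ii Ij Il ji li jl cij cil.
apply: (path_deg pathQ Ii Oi Ij Il (prism_VU i) (prism_VV ji cij) (prism_VV li cil)).
by rewrite /= !inE !xpair_eqE /= jl.
Qed.

(** Exactly [#|I| - 1] outer vertices are missing, so a list of that many missing ones accounts for
    all of them. *)
Lemma outer_rest (s : seq T) x :
  uniq s -> all [predC O] s -> #|I| = (size s).+1 -> x \notin s -> x \in O.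
Proof.
move=> us sO; rewrite card_missing_outer => -[cardO]; apply: contraR => Ox.
apply: (@exhaust _ s (~: O)); rewrite ?cardO ?inE -?mem_outer //.
by apply/allP => y /(allP sO); rewrite !inE.
Qed.

(** Acyclicity applied to the vertex set of the cycle, which may have chords, yields a vertex whose
    two cyclic neighbours coincide. *)
Lemma no_cycle (s : seq (bool * T)) : symmetric e ->
  uniq s -> 2 < size s -> cycle e s -> all [in Q] s -> False.
Proof.
move=> e_sym us lts es /allP sQ.
have [x xs] : exists x, x \in s by case: (s) lts => // x s' _; exists x; apply: mem_head.
have sAQ : [set x in s] \subset Q by apply/subsetP => y; rewrite inE => /sQ.
have [|y] := path_acyclic pathQ sAQ (x := x); rewrite ?inE // => ys leaf_y.
(* Rotating [s] to begin at [y] makes its cyclic neighbours the second and the last entry. *)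
have [n s' def_s] := rot_to ys.
have mem_s z : (z \in s) = (z \in y :: s') by rewrite -def_s mem_rot.
move: us lts es; rewrite -(rot_uniq n) -(size_rot n) -(rot_cycle n) def_s.
case: s' def_s mem_s => // a s' _ mem_s.
case/lastP: s' mem_s => // s' b mem_s us _.
rewrite /= -cats1 cat_path /= last_rcons andbT => /and3P[eya _ eby].
have /eqP : a = b.
  apply: leaf_y; rewrite ?inE ?mem_s ?in_cons ?mem_rcons ?in_cons ?eqxx ?orbT //.
  by rewrite -/e e_sym.
by move: us; rewrite /= !mem_rcons !inE => /and3P[_ /norP[/negbTE->]].
Qed.

(** * Configurations of three or four inner vertices *)

Lemma prism_sym succ pred : cyclic_rel c succ pred -> symmetric e.
Proof. by move=> csp; apply: prism_rel_sym => i j; apply: cyclic_sym csp i j. Qed.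

(** [V (succ i)] can only see its spoke and [V i] only [V (succ (succ i))], so both are leaves; a
    third leaf appears on the outer cycle. *)
Lemma no_triple_half succ pred i : cyclic_rel c succ pred ->
  all [in I] [:: i; succ i; succ (succ i)] -> #|I| = 3 ->
  i \notin O -> succ i \in O -> False.
Proof.
move=> csp allI cardI Oi Oi1; have E := succ_eqE csp.
have [Ii Ii1 Ii2] : [/\ i \in I, succ i \in I & succ (succ i) \in I].
  by move: allI; rewrite /= andbT => /and3P[].
have I3 x : x \in I -> x \in [:: i; succ i; succ (succ i)].
  by apply: exhaust; rewrite ?cardI //= !inE !E.
have leaf_i : leaf_in e Q (V i).
  apply: (leaf_inner (j := succ (succ i)) Oi) => x /I3; rewrite !inE.
  by case/or3P=> /eqP-> //; rewrite ?eqxx ?(cyclic_succ csp).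
have leaf_i1 : leaf_in e Q (V (succ i)).
  apply: leaf_inner0 => x /I3; rewrite !inE.
  by case/or3P=> /eqP-> //; rewrite ?eqxx ?(cyclic_succ csp) // (cyclic_sym csp) (cyclic_succ csp).
rewrite !mem_inner in Ii Ii1 Ii2.
have [Oi2|Oi2] := boolP (succ (succ i) \in O); last first.
  apply: (path_leaves pathQ (y := U (succ i)) Ii1 _ Ii leaf_i1 _ leaf_i).
  - by rewrite -mem_outer.
  - by apply: (leaf_outer2 csp); rewrite ?(succK csp).
  - by rewrite /= !inE !xpair_eqE /= !E.
(* The degree bound at [U (succ (succ i))] makes the next outer vertex the second missing one; the
   outer vertex after that is then a leaf. *)
have Oi3 : succ (succ (succ i)) \notin O.
  apply/negP => Oi3; apply: (outer_not_full csp Oi2 _ Oi3); first by rewrite mem_inner.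
  by rewrite (succK csp).
have Oi4 : succ (succ (succ (succ i))) \in O.
  apply: (@outer_rest [:: i; succ (succ (succ i))]); rewrite //= ?Oi ?Oi3 //.
    by rewrite inE !E.
  by rewrite !inE !E.
apply: (path_leaves pathQ (y := U (succ (succ (succ (succ i))))) Ii1 _ Ii leaf_i1 _ leaf_i).
  by rewrite -mem_outer.
  apply: (leaf_outer csp); rewrite ?(succK csp) //.
  by apply/negP => /I3; rewrite !inE !E.
by rewrite /= !inE !xpair_eqE /= !E.
Qed.

(** The middle inner vertex has no inner neighbour, so its spoke lies in the path. The degree bound
    at [U (succ i)] then puts [i] or [succ (succ i)] outside [O], and the two cases are mirror
    images. *)
Lemma no_triple succ pred i : cyclic_rel c succ pred ->
  all [in I] [:: i; succ i; succ (succ i)] -> #|I| = 3 -> False.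
Proof.
move=> csp allI cardI; have E := succ_eqE csp.
have [Ii Ii1 Ii2] : [/\ i \in I, succ i \in I & succ (succ i) \in I].
  by move: allI; rewrite /= andbT => /and3P[].
have I3 x : x \in I -> x \in [:: i; succ i; succ (succ i)].
  by apply: exhaust; rewrite ?cardI //= !inE !E.
have Oi1 : succ i \in O.
  move: (Ii1); rewrite mem_inner => /(path_nbr pathQ)[v Qv /inner_nbr[def_v|[x [def_v]]]].
    by rewrite mem_outer -def_v.
  have /I3 : x \in I by rewrite mem_inner -def_v.
  rewrite !inE => /or3P[]/eqP->; rewrite ?eqxx ?(cyclic_succ csp) //.
  by rewrite (cyclic_sym csp) (cyclic_succ csp).
have [Oi|Oi] := boolP (i \in O); last exact: no_triple_half csp allI cardI Oi Oi1.
have [Oi2|Oi2] := boolP (succ (succ i) \in O).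
  by apply: (outer_not_full csp Oi1 Ii1 Oi2); rewrite (succK csp).
apply: (no_triple_half (cyclic_rel_rev csp) _ cardI Oi2); rewrite !(succK csp) //.
by rewrite /= Ii Ii1 Ii2.
Qed.

(** The missing outer indices are exactly [i] and [j], so [V i], [U (pred i)] and [U (pred j)] are
    three leaves. *)
Lemma no_pair_half succ pred i j : cyclic_rel c succ pred ->
  all [in I] [:: i; succ i; j] -> j \notin [:: i; succ i; succ (succ i); pred i] ->
  #|I| = 3 -> i \notin O -> j \notin O -> False.
Proof.
move=> csp allI notj cardI Oi Oj.
move: notj; rewrite !inE => /norP[ji /norP[ji1 /norP[ji2 jp]]].
have E := succ_eqE csp; have E' := succ_eqE (cyclic_rel_rev csp).
have [Ii Ii1 Ij] : [/\ i \in I, succ i \in I & j \in I].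
  by move: allI; rewrite /= andbT => /and3P[].
have I3 x : x \in I -> x \in [:: i; succ i; j].
  by apply: exhaust; rewrite ?cardI //= !inE !E eq_sym (negPf ji) eq_sym (negPf ji1).
have leaf_i : leaf_in e Q (V i).
  apply: (leaf_inner (j := j) Oi) => x /I3; rewrite !inE.
  by case/or3P=> /eqP-> //; rewrite ?eqxx ?(cyclic_succ csp).
have rest x : x != i -> x != j -> x \in O.
  move=> xi xj; apply: (@outer_rest [:: i; j]); rewrite //= ?Oi ?Oj //.
    by rewrite inE eq_sym ji.
  by rewrite !inE negb_or xi.
have pj_i : pred j != i by rewrite (can2_eq (predK csp) (succK csp)).
have pj_i1 : pred j != succ i by rewrite (can2_eq (predK csp) (succK csp)).
have pi_i1 : pred i != succ i := pred_neq_succ csp i.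
have leafp x : pred x \notin [:: i; succ i; j] -> x \notin O -> leaf_in e Q (U (pred x)).
  move=> notI Ox; apply: (leaf_outer (cyclic_rel_rev csp)); last by rewrite (predK csp).
  by apply: contra notI => /I3.
rewrite !mem_inner in Ii Ii1 Ij.
apply: (path_leaves pathQ (x := V i) (y := U (pred i)) (z := U (pred j))) => //.
- by rewrite -mem_outer rest // ?E' // eq_sym.
- by rewrite -mem_outer rest // E'.
- by apply: leafp; rewrite // !inE !negb_or E' pi_i1 eq_sym jp.
- by apply: leafp; rewrite // !inE !negb_or E' pj_i pj_i1.
- by rewrite /= !inE !xpair_eqE /= E' eq_sym ji.
Qed.

(** [V j] is joined to both [V i] and [V (succ i)], which leaves no room for its spoke. If both
    other spokes are present they close a five-cycle; otherwise the preceding case applies, possibly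
    reflected. *)
Lemma no_pair succ pred i j : cyclic_rel c succ pred ->
  all [in I] [:: i; succ i; j] -> j \notin [:: i; succ i; succ (succ i); pred i] ->
  #|I| = 3 -> False.
Proof.
move=> csp allI notj cardI; have E := succ_eqE csp.
have [Ii Ii1 Ij] : [/\ i \in I, succ i \in I & j \in I].
  by move: allI; rewrite /= andbT => /and3P[].
move: (notj); rewrite !inE => /norP[ji /norP[ji1 /norP[ji2 jp]]].
have cji : ~~ c j i by rewrite (cyclic_sym csp) (cyclicE csp) negb_or ji1.
have cji1 : ~~ c j (succ i).
  by rewrite (cyclic_sym csp) (cyclicE csp) negb_or ji2 (succK csp).
have Oj : j \notin O.
  apply/negP => Oj; apply: (inner_not_full Oj Ij Ii Ii1 _ _ _ cji cji1);
    by rewrite ?E // eq_sym.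
have [Oi|Oi] := boolP (i \in O); last exact: no_pair_half csp allI notj cardI Oi Oj.
have [Oi1|Oi1] := boolP (succ i \in O); last first.
  apply: (no_pair_half (cyclic_rel_rev csp) (i := succ i) (j := j)) => //.
    by rewrite /= (succK csp) Ii Ii1 Ij.
  by rewrite !(succK csp) !inE !negb_or ji ji1 ji2 jp.
apply: (@no_cycle [:: V i; V j; V (succ i); U (succ i); U i] (prism_sym csp)) => //.
- by rewrite /= !inE !xpair_eqE /= !E eq_sym (negPf ji) (negPf ji1).
- have e_sym := prism_sym csp.
  by rewrite /= !prism_VV ?prism_VU ?prism_UV ?[e (U (succ i)) _]e_sym ?(prism_succ csp) //
     1?(cyclic_sym csp) // eq_sym.
- by rewrite /= -!mem_inner -!mem_outer Ii Ii1 Ij Oi Oi1.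
Qed.

(** The three excluded indices are all the missing ones, which makes [V (succ i)],
    [U (succ (succ i))] and the outer vertex two steps further leaves. *)
Lemma no_quad_half succ pred i : cyclic_rel c succ pred ->
  all [in I] [:: i; succ i; succ (succ i); succ (succ (succ i))] -> #|I| = 4 ->
  i \notin O -> succ i \notin O -> succ (succ (succ i)) \notin O -> False.
Proof.
move=> csp allI cardI Oi Oi1 Oi3; have E := succ_eqE csp.
have I4 x : x \in I -> x \in [:: i; succ i; succ (succ i); succ (succ (succ i))].
  by apply: exhaust; rewrite ?cardI //= !inE !E.
have Ii1 : succ i \in I by move: allI; rewrite /= => /and3P[].
have rest x : x \notin [:: i; succ i; succ (succ (succ i))] -> x \in O.
  by apply: outer_rest; rewrite //= ?Oi ?Oi1 ?Oi3 // !inE !E.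
apply: (path_leaves pathQ (x := V (succ i)) (y := U (succ (succ i)))
  (z := U (succ (succ (succ (succ i)))))).
- by rewrite -mem_inner.
- by rewrite -mem_outer rest // !inE !E.
- by rewrite -mem_outer rest // !inE !E.
- apply: (leaf_inner (j := succ (succ (succ i))) Oi1) => x /I4; rewrite !inE.
  case/or4P=> /eqP-> //; rewrite ?eqxx ?(cyclic_succ csp) //.
  by rewrite (cyclic_sym csp) (cyclic_succ csp).
- by apply: (leaf_outer2 csp); rewrite ?(succK csp).
- apply: (leaf_outer csp); rewrite ?(succK csp) //.
  by apply/negP => /I4; rewrite !inE !E.
- by rewrite /= !inE !xpair_eqE /= !E.
Qed.

(** Four consecutive inner vertices induce a path whose ends are the two middle indices. Its
    interior vertices, at [i] and the third successor, have no room for spokes; if both ends carry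
    spokes, a six-cycle closes. *)
Lemma no_quad succ pred i : cyclic_rel c succ pred ->
  all [in I] [:: i; succ i; succ (succ i); succ (succ (succ i))] -> #|I| = 4 -> False.
Proof.
move=> csp allI cardI; have E := succ_eqE csp.
have [Ii Ii1 Ii2 Ii3] : [/\ i \in I, succ i \in I, succ (succ i) \in I
    & succ (succ (succ i)) \in I].
  by move: allI; rewrite /= andbT => /and4P[].
have c2 := cyclic_succ2 csp; have c3 := cyclic_succ3 csp; have c_sym := cyclic_sym csp.
have Oi : i \notin O.
  by apply/negP => Oi; apply: (inner_not_full Oi Ii Ii2 Ii3); rewrite ?E ?c2 ?c3.
have Oi3 : succ (succ (succ i)) \notin O.
  apply/negP => Oi3; apply: (inner_not_full Oi3 Ii3 Ii Ii1); rewrite ?E //.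
    by rewrite c_sym c3.
  by rewrite c_sym c2.
have [Oi1|Oi1] := boolP (succ i \in O); last exact: no_quad_half csp allI cardI Oi Oi1 Oi3.
have [Oi2|Oi2] := boolP (succ (succ i) \in O); last first.
  apply: (no_quad_half (cyclic_rel_rev csp) _ cardI Oi3); rewrite !(succK csp) //.
  by rewrite /= Ii Ii1 Ii2 Ii3.
have e_sym := prism_sym csp.
apply: (@no_cycle [:: V (succ i); V (succ (succ (succ i))); V i; V (succ (succ i));
  U (succ (succ i)); U (succ i)] e_sym) => //.
- by rewrite /= !inE !xpair_eqE /= !E.
- rewrite /= !prism_VV ?prism_VU ?prism_UV ?E ?c2 ?c3 //.
    by rewrite e_sym (prism_succ csp).
  by rewrite c_sym c3.
- by rewrite /= -!mem_inner -!mem_outer Ii Ii1 Ii2 Ii3 Oi1 Oi2.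
Qed.

(** * Bounding the inner vertices and assembling the cases *)

Lemma inner_sparse succ pred : cyclic_rel c succ pred -> 0 < #|I| ->
  exists2 i, i \in I & {in I &, forall a b,
    a \notin [:: i; succ i; pred i] -> b \notin [:: i; succ i; pred i] -> a = b}.
Proof.
move=> csp /card_gt0P[x Ix].
have sub : [set V i | i in I] \subset Q.
  by apply/subsetP => _ /imsetP[i Ii ->]; rewrite -mem_inner.
(* This inner vertex has at most one inner neighbour, while every index of [I] outside the window
   [i], [succ i], [pred i] provides one. *)
have [_ /imsetP[i Ii ->] leaf_i] := path_acyclic pathQ sub (imset_f (fun i => V i) Ix).
exists i => // a b Ia Ib; rewrite !inE !negb_or.
move=> /and3P[ai asi api] /and3P[bi bsi bpi]; suff [] : V a = V b by [].
by apply: leaf_i; rewrite ?imset_f //; apply: prism_VV;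
  rewrite // (cyclicE csp) negb_or ?asi ?bsi.
Qed.

Lemma no_three succ pred i : cyclic_rel c succ pred ->
  i \in I -> succ i \in I -> #|I| = 3 -> False.
Proof.
move=> csp Ii Ii1 I3; have [|j Ij] := @exists_notin _ [:: i; succ i] I; first by rewrite I3.
rewrite !inE => /norP[ji ji1].
have [def_j|j_ss] := eqVneq j (succ (succ i)).
  by apply: (no_triple (i := i) csp) => //=; rewrite -def_j Ii Ii1 Ij.
have [def_j|j_p] := eqVneq j (pred i).
  by apply: (no_triple (i := j) csp) => //=; rewrite def_j !(predK csp) -def_j Ii Ii1 Ij.
by apply: (no_pair (i := i) (j := j) csp); rewrite //= ?Ii ?Ii1 ?Ij // !inE !negb_or ji ji1 j_ss.
Qed.

(** Unless the four indices are consecutive, [V (succ i)], [V (pred i)] and the fourth inner vertex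
    form a triangle. *)
Lemma no_four succ pred i : cyclic_rel c succ pred ->
  i \in I -> succ i \in I -> pred i \in I -> #|I| = 4 -> False.
Proof.
move=> csp Ii Is Ip I4; have cspr := cyclic_rel_rev csp.
have [|j Ij] := @exists_notin _ [:: i; succ i; pred i] I; first by rewrite I4.
rewrite !inE => /norP[ji /norP[js jp]].
have [def_j|j_ss] := eqVneq j (succ (succ i)).
  by apply: (no_quad (i := pred i) csp) => //=; rewrite !(predK csp) -def_j Ii Is Ip Ij.
have [def_j|j_pp] := eqVneq j (pred (pred i)).
  by apply: (no_quad (i := succ i) cspr) => //=; rewrite !(succK csp) -def_j Ii Is Ip Ij.
have c2 : c (succ i) (pred i) = false.
  by rewrite (cyclic_sym csp) -{2}[i](predK csp) (cyclic_succ2 csp).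
have ps := pred_neq_succ csp i.
apply: (@no_cycle [:: V (succ i); V (pred i); V j] (prism_sym csp)) => //.
- by rewrite /= !inE !xpair_eqE /= eq_sym (negPf ps) ![_ == j]eq_sym (negPf js) (negPf jp).
- rewrite /= andbT; apply/and3P; split; apply: prism_VV; rewrite ?c2 // 1?eq_sym //.
    by rewrite (cyclicE csp) negb_or (predK csp) ji.
  by rewrite (cyclic_sym csp) (cyclicE csp) negb_or (succK csp) j_ss.
- by rewrite /= -!mem_inner Is Ip Ij.
Qed.

Lemma prism_no_path succ pred : cyclic_rel c succ pred -> False.
Proof.
move=> csp; have cspr := cyclic_rel_rev csp.
have E := succ_eqE csp; have E' := succ_eqE cspr.
have cardIO := card_missing_outer.
have [|i Ii sparse] := inner_sparse csp; first by rewrite cardIO.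
have psE x : (pred x == succ x) = false by apply/negbTE; apply: (pred_neq_succ csp).
have spE x : (succ x == pred x) = false by rewrite eq_sym.
have dense (s : seq T) : (size s).+1 < #|I| ->
    (forall x, x \in I -> x \notin s -> x \notin [:: i; succ i; pred i]) -> False.
  move=> lt_sI out; have [a Ia sa] := exists_notin (ltnW lt_sI).
  have [b Ib] := @exists_notin _ (a :: s) I lt_sI.
  rewrite inE => /norP[/eqP ba sb]; apply: ba; apply: sparse => //; exact: out.
have le4 : #|I| <= 4.
  by rewrite leqNgt; apply/negP => gt4; apply: (dense [:: i; succ i; pred i]).
(* With one inner vertex no outer vertex is missing, so the path would contain the whole outer
   cycle. *)
have [I1|I_neq1] := eqVneq #|I| 1.
  have O_all x : x \in O by apply: (@outer_rest [::]).
  have sub : [set U i | i in O] \subset Q.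
    by apply/subsetP => _ /imsetP[x Ox ->]; rewrite -mem_outer.
  have [_ /imsetP[x _ ->] leaf_x] :=
    path_acyclic pathQ sub (imset_f (fun i => U i) (O_all i)).
  have [/eqP] : U (succ x) = U (pred x).
    apply: leaf_x; rewrite ?(imset_f (fun i => U i)) //.
      exact: prism_succ csp x.
    exact: prism_pred csp x.
  by rewrite spE.
have [I2|I_neq2] := eqVneq #|I| 2.
  (* Only [m] is missing. By the degree bound inner indices lie within one step of [m], and [V m]
     would be isolated, so [I] consists of the two neighbours of [m]; their inner edge closes the
     outer arc to a cycle. *)
  have /cards1P[m defM] : #|~: O| == 1 by rewrite -eqSS -cardIO I2.
  have OE x : (x \in O) = (x != m).
    by rewrite -in_set1 -defM in_setC negbK.
  have near_m x : x \in I -> [|| x == m, x == succ m | x == pred m].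
    move=> Ix; apply: contraT => /norP[xm /norP[xs xp]].
    case: (@outer_not_full _ _ csp x); rewrite // OE //.
      by rewrite (can2_eq (succK csp) (predK csp)).
    by rewrite (can2_eq (predK csp) (succK csp)).
  have Im : m \notin I.
    apply/negP => Im; move: (Im); rewrite mem_inner => /(path_nbr pathQ)[v Qv].
    case/inner_nbr => [def_v|[x [def_v xm]]].
      by have := OE m; rewrite mem_outer -def_v Qv eqxx.
    have /near_m : x \in I by rewrite mem_inner -def_v.
    by rewrite (negPf xm) (cyclicE csp) /= => ->.
  have [Is Ip] : succ m \in I /\ pred m \in I.
    have sub : I \subset [set succ m; pred m].
      by apply/subsetP => x Ix; have := near_m x Ix; rewrite !inE; case: eqVneq Ix Im => // -> ->.
    have/eqP-> : I == [set succ m; pred m] by rewrite eqEcard sub I2 cards2; case: eqP.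
    by rewrite !inE !eqxx orbT.
  (* Acyclicity of all of [Q] is contradicted by exhibiting two neighbours for each kind of
     vertex. *)
  have [y Qy leaf_y] := path_acyclic pathQ (subxx Q) (etrans (esym (mem_inner i)) Ii).
  case: y Qy leaf_y => [[] x]; rewrite -?mem_outer -?mem_inner => Qx leaf_x.
    have x_m : x != m by rewrite -OE.
    have {}leaf_x a b : a \in Q -> b \in Q -> e (U x) a -> e (U x) b -> a = b := leaf_x a b.
    have [xs|x_s] := eqVneq x (succ m).
      suff: V x = U (succ x) by [].
      by apply: leaf_x; rewrite -?mem_inner -?mem_outer ?prism_UV ?(prism_succ csp) ?OE // xs ?E.
    have [xp|x_p] := eqVneq x (pred m).
      suff: V x = U (pred x) by [].
      by apply: leaf_x; rewrite -?mem_inner -?mem_outer ?prism_UV ?(prism_pred csp) ?OE // xp ?E'.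
    have [/eqP] : U (succ x) = U (pred x); last by rewrite spE.
    apply: leaf_x; rewrite -?mem_outer ?(prism_succ csp) ?(prism_pred csp) // OE.
      by rewrite (can2_eq (succK csp) (predK csp)).
    by rewrite (can2_eq (predK csp) (succK csp)).
  have {}leaf_x a b : a \in Q -> b \in Q -> e (V x) a -> e (V x) b -> a = b := leaf_x a b.
  have nbr y : y \in I -> y != x -> ~~ c x y -> x != m -> False.
    move=> Iy yx cxy xm; suff: V y = U x by [].
    by apply: leaf_x; rewrite -?mem_inner -?mem_outer ?OE ?prism_VU ?prism_VV.
  case/or3P: (near_m x Qx) => /eqP def_x.
  - by rewrite -def_x Qx in Im.
  - apply: (nbr (pred m) Ip); rewrite def_x ?psE ?E //.
    by rewrite -{1}[m](predK csp) (cyclic_sym csp) (cyclic_succ2 csp).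
  - apply: (nbr (succ m) Is); rewrite def_x ?spE ?E' //.
    by rewrite -{2}[m](predK csp) (cyclic_succ2 csp).
have [I3|I_neq3] := eqVneq #|I| 3.
  have [Is|Is] := boolP (succ i \in I); first exact: no_three csp Ii Is I3.
  have [Ip|Ip] := boolP (pred i \in I); first exact: no_three cspr Ii Ip I3.
  apply: (dense [:: i]) => [|x Ix]; first by rewrite I3.
  by rewrite !inE !negb_or => -> /=; apply/andP; split; apply: contraTneq Ix => ->.
have I4 : #|I| = 4 by move: cardIO; lia.
(* At most one of the four inner indices lies outside the window, so the window itself is contained
   in [I]. *)
apply: (@no_four succ pred i) => //; apply: contraT => Ix; exfalso.
  apply: (dense [:: i; pred i]) => [|x Iy]; first by rewrite I4.
  by rewrite !inE !negb_or => /andP[-> ->] /=; rewrite andbT; apply: contraTneq Iy => ->.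
apply: (dense [:: i; succ i]) => [|x Iy]; first by rewrite I4.
by rewrite !inE !negb_or => /andP[-> ->] /=; apply: contraTneq Iy => ->.
Qed.

End PrismPath.

(** * Explicit paths after flipping a pair, on natural indices *)

Definition cyc m (i j : nat) : bool :=
  [|| i.+1 == j, j.+1 == i, (i == 0) && (j == m.-1) | (j == 0) && (i == m.-1)].

(** The exclusive or treats deletion of an edge and addition of a non-edge at once. *)
Definition flip_rel (T : eqType) (e : rel T) (x y u v : T) : bool :=
  e u v (+) ((u == x) && (v == y) || (u == y) && (v == x)).

(* [q 0], ..., [q m] is an induced path once the adjacency of [x] and [y] is flipped. *)
Definition flip_path m (x y : bool * nat) (q : nat -> bool * nat) : Prop :=
  forall s t, s < t <= m ->
  [/\ (q s).2 < m, (q t).2 < m, q s != q t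
    & flip_rel (prism_rel (cyc m)) x y (q s) (q t) = (s.+1 == t)].

Ltac split_ltn :=
  repeat match goal with |- context [if (?a < ?b)%N then _ else _] =>
    case: (ltnP a b) => ?; try (exfalso; lia) end.

Ltac decide_eqn :=
  repeat match goal with |- context [@eq_op _ ?a ?b] =>
    first [ rewrite (_ : (a == b) = false); [|lia]
          | rewrite (_ : (a == b) = true); [|lia]
          | case: (@eqP _ a b) => ? ]
  end.

Ltac solve_flip_path :=
  intros ? ? ?; rewrite /flip_rel /prism_rel /cyc /=; split_ltn;
  (split; [move=> /=; lia | move=> /=; lia | |]);
  rewrite ?xpair_eqE /=; decide_eqn => //=; lia.

(** The outer cycle is cut open at the deleted edge and prolonged by the spoke at [U 1]. *)
Lemma flip_path_outer1 m : 4 < m -> flip_path m (U 0) (U 1)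
  (fun t => if t < 1 then V 1 else if t < m then U t else U 0).
Proof. by move=> m5; solve_flip_path. Qed.

(** The path is [V 1], [V (j+1)], [V 2], [U 2], ..., [U j], [U 0], [U (m-1)], ..., [U (j+2)]; the
    new edge is its step from [U j] to [U 0]. *)
Lemma flip_path_outer_far m j : 2 < j < m.-1 -> flip_path m (U 0) (U j)
  (fun t => if t < 1 then V 1 else if t < 2 then V j.+1 else if t < 3 then V 2 else
   if t < j.+2 then U t.-1 else if t < j.+3 then U 0 else U (m + j.+2 - t)).
Proof. by move=> m5; solve_flip_path. Qed.

Lemma flip_path_spoke m : 4 < m -> flip_path m (U 0) (V 0)
  (fun t => if t < 1 then V 0 else if t < 2 then V 2 else if t < m then U t else U 0).
Proof. by move=> m5; solve_flip_path. Qed.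

Lemma flip_path_cross1 m : 4 < m -> flip_path m (U 0) (V 1)
  (fun t => if t < 1 then V 1 else if t < 2 then U 0 else if t < m then U (m.+1 - t) else V 2).
Proof. by move=> m5; solve_flip_path. Qed.

(** Outer indices [1] and [j] are left out; the inner edge from [V (j-1)] to [V (j+1)] bypasses
    [U j], and [V j] hangs off [U 0] by the new edge. *)
Lemma flip_path_cross_far m j : 1 < j < m.-1 -> 4 < m -> flip_path m (U 0) (V j)
  (fun t => if t < j.-2 then U t.+2 else if t < j.-1 then V j.-1 else if t < j then V j.+1
   else if t < m.-1 then U t.+1 else if t < m then U 0 else V j).
Proof. by move=> j_far m5; solve_flip_path. Qed.

Lemma flip_path_inner1 m : 4 < m -> flip_path m (V 0) (V 1)
  (fun t => if t < m.-1 then U (m.-1 - t) else if t < m then V 1 else V 0).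
Proof. by move=> m5; solve_flip_path. Qed.

Lemma flip_path_inner2 m : 4 < m -> flip_path m (V 0) (V 2)
  (fun t => if t < 1 then V 0 else if t < 2 then U 0 else if t < m then U (m.+1 - t) else V 2).
Proof. by move=> m5; solve_flip_path. Qed.

(** [V j], [V 1], [V (j+1)], [V 0] induce a four-cycle; the deletion opens it, and outer arcs
    prolong it at both ends. The second arc stops one short of [U (j+2)] so that the path has
    exactly [m + 1] vertices. *)
Lemma flip_path_inner_far m j : 2 < j < m.-2 -> flip_path m (V 0) (V j)
  (fun t => if t < j.-1 then U t.+2 else if t < j then V j else if t < j.+1 then V 1
   else if t < j.+2 then V j.+1 else if t < j.+3 then V 0 else if t < j.+4 then U 0
   else U (m + j.+3 - t)).
Proof. by move=> m5; solve_flip_path. Qed.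

(** An offset out of range for the direct constructions comes into range when reflected to [m - j].
    The condition [b ==> a] puts the outer vertex of a mixed pair first. *)
Lemma flip_path_exists m a b j : 4 < m -> j < m -> (a, 0) != (b, j) -> (b ==> a) ->
  exists q, flip_path m (a, 0) (b, j) q \/ 0 < j /\ flip_path m (a, 0) (b, m - j) q.
Proof.
move=> m5 jm; case: a b => [] [] //= ne _.
- have {ne} j_gt0 : 0 < j by move: ne; rewrite xpair_eqE /=; lia.
  have [->|j1] := eqVneq j 1; first by eexists; left; exact: flip_path_outer1.
  have [le_j|lt_j] := leqP j 2.
    eexists; right; split=> //; apply: flip_path_outer_far; lia.
  have [lt_j'|le_j] := ltnP j m.-1; first by eexists; left; apply: flip_path_outer_far; lia.
  by eexists; right; split=> //; rewrite (_ : m - j = 1); [exact: flip_path_outer1 | lia].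
- have [->|j_gt0] := posnP j; first by eexists; left; exact: flip_path_spoke.
  have [->|j1] := eqVneq j 1; first by eexists; left; exact: flip_path_cross1.
  have [lt_j'|le_j] := ltnP j m.-1; first by eexists; left; apply: flip_path_cross_far; lia.
  by eexists; right; split=> //; rewrite (_ : m - j = 1); [exact: flip_path_cross1 | lia].
- have {ne} j_gt0 : 0 < j by move: ne; rewrite xpair_eqE /=; lia.
  have [->|j1] := eqVneq j 1; first by eexists; left; exact: flip_path_inner1.
  have [->|j2] := eqVneq j 2; first by eexists; left; exact: flip_path_inner2.
  have [lt_j'|le_j] := ltnP j m.-2; first by eexists; left; apply: flip_path_inner_far; lia.
  have [def_j|j_m2] := eqVneq (m - j) 1.
    by eexists; right; split=> //; rewrite def_j; exact: flip_path_inner1.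
  by eexists; right; split=> //; rewrite (_ : m - j = 2); [exact: flip_path_inner2 | lia].
Qed.

(** * From flipped embeddings to induced saturation *)

Lemma contains_pathP (G : sgraph) k :
  contains_induced G (path_graph k) <->
  exists p : 'I_k -> G, injective p /\ forall i j, adj (p i) (p j) = path_adj i j.
Proof.
split=> [[S [f [g fK gK] adj_f]]|[p [inj_p adj_p]]].
  exists (fun i => val (g i)); split=> [i j /val_inj /(can_inj gK)//|i j].
  by rewrite -[LHS]/(adj (g i) (g j)) -adj_f !gK.
pose S := p @: 'I_k; have Sp i : p i \in S by apply: imset_f.
pose q i : induced S := Sub (p i) (Sp i).
have inj_q : injective q by move=> i j /(congr1 val) /inj_p.
have [f fK qK] : bijective q.
  by apply: inj_card_bij => //; rewrite card_sig /= card_imset // cardE size_enum_ord card_ord.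
exists S, f; first by exists q.
by move=> u v; rewrite -[in RHS](qK u) -[in RHS](qK v) -[RHS]/(adj (p _) (p _)) adj_p.
Qed.

(** A flip deletes an edge and adds a non-edge, so one family of embeddings serves both saturation
    clauses. *)
Lemma flip_saturated (G : sgraph) k :
  ~ contains_induced G (path_graph k) ->
  (forall x y : G, x != y -> exists p : 'I_k -> G, injective p /\
     forall i j, flip_rel (@adj G) x y (p i) (p j) = path_adj i j) ->
  induced_saturated (path_graph k) G.
Proof.
move=> free flips.
have set2_eq (x y u v : G) : x != y ->
    ([set u; v] == [set x; y]) = (u == x) && (v == y) || (u == y) && (v == x).
  move=> xy; apply/eqP/idP => [/setP eq_uv|/orP[]/andP[/eqP-> /eqP->]//]; last exact: setUC.
  have := eq_uv v; have := eq_uv u; rewrite !inE !eqxx orbT /= => /esym/orP[]/eqP def_u;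
    move=> /esym/orP[]/eqP def_v; rewrite def_u def_v ?eqxx ?orbT //.
  - by have := eq_uv y; rewrite !inE def_u def_v eqxx orbT orbb eq_sym (negPf xy).
  - by have := eq_uv x; rewrite !inE def_u def_v eqxx orbb (negPf xy).
have adj_set2 (x y u v : G) : (u == x) && (v == y) || (u == y) && (v == x) ->
    adj u v = adj x y.
  by case/orP=> /andP[/eqP-> /eqP->] //; rewrite adj_sym.
split=> // x y.
- move=> adj_xy; have xy : x != y by apply: contraTneq adj_xy => ->; rewrite adj_irr.
  have [p [inj_p adj_p]] := flips x y xy.
  apply/contains_pathP; exists p; split=> // i j; rewrite -adj_p /= /del_adj /flip_rel set2_eq //.
  have [/adj_set2->|_] := boolP (_ && _ || _); by rewrite ?adj_xy ?addbF ?andbT.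
- move=> xy nadj; have [p [inj_p adj_p]] := flips x y xy.
  apply/contains_pathP; exists p; split=> // i j; rewrite -adj_p /= /add_adj /flip_rel set2_eq //.
  have [eq_ij|_] := boolP (_ && _ || _).
    rewrite (adj_set2 _ _ _ _ eq_ij) (negPf nadj) /= andbT.
    by case/orP: eq_ij => /andP[/eqP-> /eqP->]; rewrite // eq_sym.
  by rewrite addbF orbF andb_idl //; apply: contraTneq => ->; rewrite adj_irr.
Qed.

(** * The prism on ordinals and its symmetries *)

Section Prism.
Variable m : nat.

Fact prism_adj_sym : symmetric (prism_rel (relpre (@nat_of_ord m) (cyc m))).
Proof. by apply: prism_rel_sym => i j /=; rewrite /cyc; lia. Qed.

Fact prism_adj_irr : irreflexive (prism_rel (relpre (@nat_of_ord m) (cyc m))).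
Proof. by move=> [a i]; rewrite /prism_rel /= !eqxx. Qed.

Definition prism : sgraph := SGraph prism_adj_sym prism_adj_irr.

Lemma cyclic_rel_ord : 4 < m ->
  cyclic_rel (relpre (@nat_of_ord m) (cyc m)) (@ordS m) (@ord_pred m).
Proof.
move=> m5.
(* Conditional forms of the modular successor and predecessor keep the arithmetic linear. *)
have ordSE (i : 'I_m) : val (ordS i) = if (val i).+1 < m then (val i).+1 else 0.
  rewrite /=; case: ltnP => [/modn_small//|le_m].
  by have -> : i.+1 = m by [have := ltn_ord i; lia]; rewrite modnn.
have ord_predE (i : 'I_m) : val (ord_pred i) = if val i < 1 then m.-1 else (val i).-1.
  have lt_i := ltn_ord i; rewrite /=; case: ltnP => [lt_i1|gt0].
    by rewrite (_ : (i + m).-1 = m.-1) ?modn_small; lia.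
  by rewrite (_ : (i + m).-1 = i.-1 + m) ?modnDr ?modn_small; lia.
split; [exact: ordSK | exact: ord_predK | | | ].
- move=> i j; rewrite -!val_eqE ordSE ord_predE /= /cyc.
  by have := ltn_ord i; have := ltn_ord j; split_ltn; lia.
- move=> i; rewrite /= !inE -!val_eqE !ordSE /=.
  by have := ltn_ord i => ?; split_ltn; lia.
- move=> i; rewrite /= !inE -!val_eqE !ord_predE /=.
  by have := ltn_ord i => ?; split_ltn; lia.
Qed.

Lemma prism_free : 4 < m -> ~ contains_induced prism (path_graph m.+1).
Proof.
move=> m5 /contains_pathP[p [inj_p adj_p]].
have cardQ : #|p @: 'I_m.+1| = #|'I_m|.+1 by rewrite card_imset // !card_ord.
have pathQ : path_like (@adj prism) (p @: 'I_m.+1) by apply: (path_like_image inj_p adj_p); lia.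
exact: (@prism_no_path _ _ _ pathQ cardQ _ _ (cyclic_rel_ord m5)).
Qed.

(** A symmetry [f] of the index cycle induces an automorphism of the prism, which carries the
    explicit path along. *)
Lemma flip_path_transport (f : 'I_m -> 'I_m) a b (i j : 'I_m) q :
  injective f -> (forall u v : 'I_m, cyc m (f u) (f v) = cyc m u v) ->
  (a, i) != (b, j) -> flip_path m (a, val i) (b, val j) q ->
  exists p : 'I_m.+1 -> prism, injective p /\
    forall s t, flip_rel (@adj prism) (a, f i) (b, f j) (p s) (p t) = path_adj s t.
Proof.
(* The default [i] of [insubd] is never reached, since [flip_path] keeps all indices below [m]. *)
move=> inj_f cyc_f ne_ij qP; pose vtx x : prism := (x.1, f (insubd i x.2)).
have vtx_eq x y : x.2 < m -> y.2 < m -> (vtx x == vtx y) = (x == y).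
  case: x y => [d x] [d' y] /= lt_x lt_y.
  by rewrite !xpair_eqE (inj_eq inj_f) -val_eqE /= !val_insubd lt_x lt_y.
have vtx_val (d : bool) (l : 'I_m) : vtx (d, val l) = (d, f l) by rewrite /vtx /= valKd.
have flipE x y : x.2 < m -> y.2 < m ->
    flip_rel (@adj prism) (a, f i) (b, f j) (vtx x) (vtx y)
    = flip_rel (prism_rel (cyc m)) (a, val i) (b, val j) x y.
  move=> lt_x lt_y; rewrite /flip_rel -!vtx_val !vtx_eq ?ltn_ord //; congr (_ (+) _).
  rewrite /= /prism_rel /= cyc_f (inj_eq inj_f) -val_eqE /= !val_insubd.
  by rewrite lt_x lt_y.
exists (fun s : 'I_m.+1 => vtx (q s)).
have lt_q (s t : 'I_m.+1) : s < t -> _ := fun st => qP s t (introT andP (conj st (leq_ord t))).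
split=> s t.
  case: (ltngtP s t) => [/lt_q[lts ltt ne _]|/lt_q[lts ltt ne _]|/val_inj//] /eqP.
    by rewrite vtx_eq // (negPf ne).
  by rewrite eq_sym vtx_eq // (negPf ne).
rewrite /path_adj; case: (ltngtP s t) => [st|ts|/val_inj->].
- have [lts ltt _ eq_st] := lt_q _ _ st; rewrite flipE // eq_st; lia.
- have [lts ltt _ eq_st] := lt_q _ _ ts.
  have -> : flip_rel (@adj prism) (a, f i) (b, f j) (vtx (q s)) (vtx (q t))
          = flip_rel (@adj prism) (a, f i) (b, f j) (vtx (q t)) (vtx (q s)).
    by rewrite /flip_rel adj_sym orbC ![_ && (vtx (q s) == _)]andbC.
  rewrite flipE // eq_st; lia.
- rewrite /flip_rel adj_irr /= [X in _ || X]andbC orbb.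
  have -> : (vtx (q t) == (a, f i)) && (vtx (q t) == (b, f j)) = false; last lia.
  apply/negP => /andP[/eqP->]; rewrite xpair_eqE (inj_eq inj_f) -xpair_eqE.
  exact/negP.
Qed.

Lemma prism_flip (x y : prism) : 4 < m -> x != y ->
  exists p : 'I_m.+1 -> prism, injective p /\
    forall s t, flip_rel (@adj prism) x y (p s) (p t) = path_adj s t.
Proof.
move=> m5; wlog sides : x y / (y.1 ==> x.1).
  move=> wl ne; have [/wl/(_ ne)//|] := boolP (y.1 ==> x.1).
  rewrite negb_imply => /andP[y1 /negPf x1].
  have [||p [inj_p adj_p]] := wl y x; rewrite ?x1 ?y1 // 1?eq_sym //.
  by exists p; split=> // s t; rewrite -adj_p /flip_rel orbC.
case: x y sides => [a x] [b y] /= sides ne.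
have [lt_x lt_y] := (ltn_ord x, ltn_ord y).
have m_gt0 : 0 < m by lia.
pose o0 := Ordinal m_gt0; pose j := if y < x then y + m - x else y - x.
have lt_j : j < m by rewrite /j; split_ltn; lia.
have j0 : (j == 0) = (x == y) by rewrite -val_eqE /= /j; split_ltn; lia.
(* Modulo [m], the rotation by [x] sends [0] to [x] and [j] to [y]; the reflection taking [i] to
   [x - i] sends [0] to [x] and [m - j] to [y]. *)
have rot_lt (i : 'I_m) : (if x + i < m then x + i else x + i - m) < m.
  by have := ltn_ord i => lt_i; split_ltn; lia.
have ref_lt (i : 'I_m) : (if x < i then x + m - i else x - i) < m.
  by have := ltn_ord i => lt_i; split_ltn; lia.
have [|q [qP|[j_gt0 qP]]] := @flip_path_exists m a b j m5 lt_j _ sides.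
- by move: ne; rewrite !xpair_eqE -j0 [0 == j]eq_sym.
- have fx : Ordinal (rot_lt o0) = x by apply: val_inj => /=; rewrite addn0 lt_x.
  have fy : Ordinal (rot_lt (Ordinal lt_j)) = y.
    by apply: val_inj; rewrite /= /j; case: (ltnP y x) => *; split_ltn; lia.
  rewrite -fx -fy.
  apply: (@flip_path_transport (fun i => Ordinal (rot_lt i)) a b o0 (Ordinal lt_j) q _ _ _ qP).
  + move=> u v /(congr1 val) /= eq_uv; apply: val_inj => /=; move: eq_uv.
    by have := ltn_ord u => lt_u; have := ltn_ord v => lt_v; split_ltn; lia.
  + move=> u v /=; have := ltn_ord u => lt_u; have := ltn_ord v => lt_v.
    by rewrite /cyc; split_ltn; lia.
  + by move: ne; rewrite !xpair_eqE -j0 -[o0 == _]val_eqE /= [0 == j]eq_sym.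
- have lt_mj : m - j < m by lia.
  have fx : Ordinal (ref_lt o0) = x by apply: val_inj => /=; rewrite subn0.
  have fy : Ordinal (ref_lt (Ordinal lt_mj)) = y.
    by apply: val_inj; move: j_gt0; rewrite /= /j; case: (ltnP y x) => *; split_ltn; lia.
  rewrite -fx -fy.
  apply: (@flip_path_transport (fun i => Ordinal (ref_lt i)) a b o0 (Ordinal lt_mj) q _ _ _ qP).
  + move=> u v /(congr1 val) /= eq_uv; apply: val_inj => /=; move: eq_uv.
    by have := ltn_ord u => lt_u; have := ltn_ord v => lt_v; split_ltn; lia.
  + move=> u v /=; have := ltn_ord u => lt_u; have := ltn_ord v => lt_v.
    by rewrite /cyc; split_ltn; lia.
  + rewrite xpair_eqE -val_eqE /=; lia.
Qed.

Lemma prism_saturated : 4 < m -> induced_saturated (path_graph m.+1) prism.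
Proof.
move=> m5; apply: flip_saturated (prism_free m5) _ => x y; exact: prism_flip.
Qed.

End Prism.

(** * The triangle, and the choice of graph for each [n] *)

Fact neq_sym (T : eqType) : symmetric (fun x y : T => x != y).
Proof. by move=> x y; rewrite eq_sym. Qed.

Fact neq_irr (T : eqType) : irreflexive (fun x y : T => x != y).
Proof. by move=> x; rewrite eqxx. Qed.

Definition triangle : sgraph := SGraph (@neq_sym 'I_3) (@neq_irr 'I_3).

(** A path on three vertices needs non-adjacent ends; any flip deletes an edge and leaves the third
    vertex as the middle of such a path. *)
Lemma triangle_saturated : induced_saturated (path_graph 3) triangle.
Proof.
apply: flip_saturated => [/contains_pathP[p [inj_p adj_p]]|x y xy].
  by have := adj_p ord0 ord_max; rewrite /= (inj_eq inj_p).
have [|z _] := @exists_notin _ [:: x; y] [set: 'I_3]; first by rewrite cardsT card_ord.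
rewrite !inE => /norP[zx zy].
exists (fun i : 'I_3 => if i < 1 then x else if i < 2 then z else y); split.
  move=> [[|[|[|//]]] ?] [[|[|[|//]]] ?] //= /eqP;
    by rewrite ?[_ == z]eq_sym ?(negPf zx) ?(negPf zy) ?[y == x]eq_sym
      ?(negPf xy) // => _; apply: val_inj.
move=> [[|[|[|//]]] ?] [[|[|[|//]]] ?];
  by rewrite /flip_rel /path_adj /= ?[_ == z]eq_sym ?eqxx ?(negPf zx) ?(negPf zy)
     ?[y == x]eq_sym ?(negPf xy).
Qed.

Theorem theorem1p2 (n : nat) (hn : 0 < n) :
  exists G : sgraph, 1 < #|G| /\ induced_saturated (path_graph (3 * n)) G.
Proof.
have [n1|n_gt1] : n = 1 \/ 1 < n by lia.
  by rewrite n1; exists triangle; rewrite card_ord; split=> //; apply: triangle_saturated.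
(* Here [3 * n] is at least six, so the cycle length is at least five. *)
exists (prism (3 * n).-1); split.
  by rewrite card_prod card_bool card_ord; lia.
have {1}-> : 3 * n = (3 * n).-1.+1 by lia.
by apply: prism_saturated; lia.
Qed.
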